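(* For every positive integer $k$, $r(k,k,k) = 3k-2$.
   Context: In an edge-coloured graph, a connected matching of colour $C$ is a matching (set of pairwise disjoint edges) all of whose edges have colour $C$ and lie in a single connected component of the graph spanned by the edges of colour $C$. A $k$-connected matching is a connected matching consisting of $k$ edges. For positive integers $k,l,m$, $r(k,l,m)$ denotes the smallest integer $n$ such that every colouring of the edges of the complete bipartite graph $K_{n,n}$ with the three colours red, green and blue contains a red $k$-connected matching, a green $l$-connected matching or a blue $m$-connected matching. *)

(* Defs.v *)
From HB Require Import structures.
From mathcomp Require Import all_boot.

Set Implicit Arguments.
Unset Strict Implicit.
Unset Printing Implicit Defensive.

Variant colour := Red | Green | Blue.

Definition ord_of_colour (C : colour) : 'I_3 :=
  match C with Red => inord 0 | Green => inord 1 | Blue => inord 2 end.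

Definition colour_of_ord (i : 'I_3) : colour :=
  match val i with 0 => Red | 1 => Green | _ => Blue end.

Lemma ord_of_colourK : cancel ord_of_colour colour_of_ord.
Proof. by case; rewrite /colour_of_ord /= inordK. Qed.

HB.instance Definition _ := Finite.copy colour (can_type ord_of_colourK).

(* K_{n,n} has vertex set 'I_n + 'I_n; the pair (i, j) stands for the edge
   joining the left vertex inl i to the right vertex inr j. *)
Definition vertex (n : nat) : finType := ('I_n + 'I_n)%type.
Definition edge (n : nat) : finType := ('I_n * 'I_n)%type.
Definition colouring (n : nat) := {ffun edge n -> colour}.

Definition colour_adj n (c : colouring n) (C : colour) : rel (vertex n) :=
  fun x y => match x, y with
             | inl i, inr j | inr j, inl i => c (i, j) == C
             | _, _ => false
             end.

Definition is_matching n (M : {set edge n}) : bool :=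
  [forall e in M, forall f in M,
    (e != f) ==> (e.1 != f.1) && (e.2 != f.2)].

(* The component is given by a vertex v of it. *)
Definition connected_matching n (c : colouring n) (C : colour)
    (M : {set edge n}) : bool :=
  [&& is_matching M,
      [forall e in M, c e == C]
    & [exists v : vertex n, [forall e in M,
         connect (colour_adj c C) v (inl e.1)
         && connect (colour_adj c C) v (inr e.2)]]].

Definition has_connected_matching n (c : colouring n) (C : colour) (k : nat) :
    Prop :=
  exists M : {set edge n}, connected_matching c C M /\ #|M| = k.

Definition ramsey_prop (k l m n : nat) : Prop :=
  forall c : colouring n,
    [\/ has_connected_matching c Red k,
        has_connected_matching c Green l
      | has_connected_matching c Blue m].

(* r(k, l, m) = r; in particular the minimum exists. *)
Definition is_ramsey_number (k l m r : nat) : Prop :=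
  ramsey_prop k l m r /\ forall n, ramsey_prop k l m n -> r <= n.

(* Main.v *)
(* Put t = k - 1 and suppose that a colouring of K_{n,n} with n > 3t has no
   connected matching with k edges. By König's theorem every monochromatic
   component has a vertex cover of size at most t. Call a vertex marked in
   colour i when it lies in the cover of its colour i component. The two ends
   of every edge then share a component in which one of them is marked, while
   any 3 components leave a vertex unmarked on each side, and any 6 components
   leave a vertex unmarked on some side. Asking repeatedly for such unmarked
   vertices and splitting according to the components that contain them leads
   to a contradiction in every branch, once one distinguishes whether some
   vertex has only one mark. The resulting finite case tree was found by a
   computer search.

   For the lower bound, the left side of K_{3t,3t} is cut into three parts of
   size t, each with its own colour. *)

Require Import Defs.
From mathcomp Require Import all_boot zify.

Set Implicit Arguments.
Unset Strict Implicit.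
Unset Printing Implicit Defensive.

(** * König's theorem *)

Section Konig.
Variables A B : finType.
Implicit Types (e : A -> B -> bool) (SA : {set A}) (SB : {set B}).

Definition vertex_cover e SA SB := forall a b, e a b -> (a \in SA) || (b \in SB).

Definition matching_of e (M : {set A * B}) :=
  (forall p, p \in M -> e p.1 p.2) /\
  (forall p q, p \in M -> q \in M -> p != q -> (p.1 != q.1) && (p.2 != q.2)).

Lemma matching_of_union e e1 e2 M1 M2 :
    (forall a b, e1 a b -> e a b) -> (forall a b, e2 a b -> e a b) ->
    (forall a b a' b', e1 a b -> e2 a' b' -> (a != a') && (b != b')) ->
    matching_of e1 M1 -> matching_of e2 M2 ->
  matching_of e (M1 :|: M2) /\ #|M1 :|: M2| = #|M1| + #|M2|.
Proof.
move=> e1e e2e e12 [M1e M1d] [M2e M2d].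
have sep p q : p \in M1 -> q \in M2 -> (p.1 != q.1) && (p.2 != q.2).
  by move=> /M1e pe /M2e qe; apply: e12 pe qe.
split; first split.
- by move=> p /setUP[/M1e/e1e|/M2e/e2e].
- move=> p q /setUP[pM|pM] /setUP[qM|qM] pq; [exact: M1d|exact: sep| |exact: M2d].
  by rewrite eq_sym [_.2 == _]eq_sym; apply: sep.
rewrite cardsU [_ :&: _](_ : _ = set0) ?cards0 ?subn0 //.
apply/setP => p; rewrite !inE; apply/negP => /andP[p1 p2].
by have := sep _ _ p1 p2; rewrite eqxx.
Qed.

(* If deleting the ends of an edge ab lowers the minimum size of a cover by two,
   then some minimum cover (DA, DB) contains both a and b, and the matching is
   assembled from DA x (B \ DB) and (A \ DA) x DB, whose minimum covers are
   smaller than m. *)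
Lemma konig m e :
    (forall SA SB, vertex_cover e SA SB -> m <= #|SA| + #|SB|) ->
  exists2 M, matching_of e M & #|M| = m.
Proof.
elim/ltn_ind: m e => -[|m] IH e cov.
  exists set0; last by rewrite cards0.
  by split=> [p|p q]; rewrite inE.
have [/existsP[a /existsP[b eab]]|noe] := boolP [exists a, exists b, e a b]; last first.
  have /cov : vertex_cover e set0 set0; last by rewrite !cards0.
  by move=> a b eab; case/negP: noe; apply/existsP; exists a; apply/existsP; exists b.
pose e' x y := [&& e x y, x != a & y != b].
have [/existsP[SA /existsP[SB /andP[/forallP cov' lt_m]]]|large] :=
  boolP [exists SA : {set A}, exists SB : {set B},
     [forall x, forall y, e' x y ==> (x \in SA) || (y \in SB)]
       && (#|SA| + #|SB| < m)].
  have covD : vertex_cover e (a |: SA) (b |: SB).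
    move=> x y exy; rewrite !inE; case: eqVneq => //= xa.
    case: eqVneq => //= yb; first by rewrite orbT.
    by have /forallP/(_ y)/implyP := cov' x; apply; rewrite /e' exy xa.
  set DA := a |: SA in covD *; set DB := b |: SB in covD *.
  have sizeA : #|DA| <= #|SA|.+1 by rewrite cardsU1; case: (_ \notin _).
  have sizeB : #|DB| <= #|SB|.+1 by rewrite cardsU1; case: (_ \notin _).
  have sizeD := cov _ _ covD.
  have posA : 0 < #|DA| by apply/card_gt0P; exists a; rewrite !inE eqxx.
  have posB : 0 < #|DB| by apply/card_gt0P; exists b; rewrite !inE eqxx.
  pose e1 x y := [&& e x y, x \in DA & y \notin DB].
  pose e2 x y := [&& e x y, x \notin DA & y \in DB].
  have [||M1 M1m M1c] := IH #|DA| _ e1; first lia.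
    (* A cover of [e1] enlarged by [DB] covers [e], hence a cover of [e1] has at least [#|DA|]
       vertices. *)
    move=> UA UB covU; suff /cov : vertex_cover e UA (UB :|: DB).
      have := (leq_card_setU UB DB).1; lia.
    move=> x y exy; rewrite inE; have [yD|yD] := boolP (y \in DB); first by rewrite !orbT.
    rewrite orbF; apply: covU; rewrite /e1 exy yD andbT /=.
    by have := covD _ _ exy; rewrite (negbTE yD) orbF.
  have [||M2 M2m M2c] := IH #|DB| _ e2; first lia.
    move=> UA UB covU; suff /cov : vertex_cover e (UA :|: DA) UB.
      have := (leq_card_setU UA DA).1; lia.
    move=> x y exy; rewrite inE; have [xD|xD] := boolP (x \in DA); first by rewrite !orbT.
    rewrite orbF; apply: covU; rewrite /e2 exy xD /=.
    by have := covD _ _ exy; rewrite (negbTE xD).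
  have [|||M12 M12c] := @matching_of_union e e1 e2 M1 M2 _ _ _ M1m M2m.
  - by move=> x y /andP[].
  - by move=> x y /andP[].
  - move=> x y x' y' /and3P[_ xD yD] /and3P[_ xD' yD'].
    by rewrite (memPn xD' _ xD) eq_sym (memPn yD).
  exists (M1 :|: M2) => //; rewrite M12c M1c M2c.
  by apply/eqP; rewrite eqn_leq sizeD andbT; lia.
(* Otherwise every cover of [e'] has at least [m] vertices, and the edge from [a] to [b] extends a
   matching of [m] edges of [e']. *)
have [||M M_m Mc] := IH m _ e'; first by [].
  move=> SA SB covS; rewrite leqNgt; apply: contra large => lt_m.
  apply/existsP; exists SA; apply/existsP; exists SB; rewrite lt_m andbT.
  by apply/forallP => x; apply/forallP => y; apply/implyP/covS.
pose e2 x y := (x == a) && (y == b).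
have [||||M12 M12c] := @matching_of_union e e' e2 M [set (a, b)] _ _ _ M_m _.
- by move=> x y /andP[].
- by move=> x y /andP[/eqP-> /eqP->].
- by move=> x y x' y' /and3P[_ xa yb] /andP[/eqP-> /eqP->]; rewrite xa.
- by split=> [p /set1P-> | p q /set1P-> /set1P->]; rewrite /e2 ?eqxx.
by exists (M :|: [set (a, b)]) => //; rewrite M12c cards1 Mc addn1.
Qed.
End Konig.

(** Pairs of vertex sets form a finite type, so the existence of a small cover is decidable and the
    alternative is constructive. *)
Lemma konig_cover (A B : finType) (m : nat) (e : A -> B -> bool) :
  (exists2 M, matching_of e M & #|M| = m) \/
  exists2 D : {set A} * {set B}, vertex_cover e D.1 D.2 & #|D.1| + #|D.2| < m.
Proof.
have [/existsP[D /andP[/forallP cov lt_m]]|large] :=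
  boolP [exists D : {set A} * {set B},
    [forall a, forall b, e a b ==> (a \in D.1) || (b \in D.2)]
      && (#|D.1| + #|D.2| < m)].
  by right; exists D => // a b; have /forallP/(_ b)/implyP := cov a.
left; apply: konig => SA SB cov; rewrite leqNgt; apply: contra large => lt_m.
apply/existsP; exists (SA, SB); rewrite lt_m andbT.
by apply/forallP => a; apply/forallP => b; apply/implyP/cov.
Qed.

(** * Refutation of cover systems by a case tree *)

(* [ca i a] is the colour [i] component of [a], and [ma i a] tells whether [a]
   belongs to the cover of that component; likewise for [cb] and [mb]. *)
Definition cover_system (A B : finType) (K : eqType) (t : nat)
    (ca : nat -> A -> K) (ma : nat -> A -> bool)
    (cb : nat -> B -> K) (mb : nat -> B -> bool) : Prop :=
  [/\ 3 * t < #|A|, 3 * t < #|B|,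
      forall i k, i < 3 ->
        #|[pred a | (ca i a == k) && ma i a]|
          + #|[pred b | (cb i b == k) && mb i b]| <= t
    & forall a b, exists2 i, i < 3 & (ca i a == cb i b) && (ma i a || mb i b)].

(* Entry [i] of a label is the index of the colour [i] component of a vertex in
   a list of known components, with [false] only if the vertex is known to be
   unmarked there. A state consists of the numbers of known components of each
   colour and of labels of vertices known to exist on the left and on the right. *)
Definition label := seq (nat * bool).
Definition state := (seq nat * seq label * seq label)%type.

(** A necessary condition on labels of opposite sides: the joining edge lies in a common component
    where one end may be marked. *)
Definition agree (v w : label) : bool :=
  has (fun p => (p.1.1 == p.2.1) && (p.1.2 || p.2.2)) (zip v w).

Lemma agreeC v w : agree v w = agree w v.
Proof.
elim: v w => [|p v IH] [|r w] //; rewrite /agree /= eq_sym orbC.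
by rewrite orbC [p.2 || _]orbC; congr (_ || _); apply: IH.
Qed.

Definition names_of_mask (m : nat) : seq nat :=
  [seq j <- iota 0 6 | odd (m %/ 2 ^ j)].

(* The query (s, m0, m1, m2) asks for a vertex on the side [s] that is unmarked
   in the components selected by the binary digits of m0, m1 and m2. *)
Variant side := L | R | LR.
Definition query := (side * nat * nat * nat)%type.

Definition chosen (q : query) : seq (seq nat) :=
  let: (_, m0, m1, m2) := q in [seq names_of_mask m | m <- [:: m0; m1; m2]].

(** Three components hold at most 3t marked vertices, fewer than either side has; six hold at most
    6t, fewer than both sides together have. *)
Definition admissible (q : query) : bool :=
  sumn [seq size s | s <- chosen q] <= (if q.1.1.1 is LR then 6 else 3).

(** The last index, [nth 0 ks i], stands for a component not seen before. Nothing is known of a mark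
    there, so its flag is [true]. *)
Definition coordinates (ks : seq nat) (S : seq (seq nat)) (i : nat) :=
  [seq (j, ~~ ((j < nth 0 ks i) && (j \in nth [::] S i)))
     | j <- iota 0 (nth 0 ks i).+1].

(** The flags [true] bound the marks from above, so a vertex with at least [mn] marks has at least
    [mn] such flags. *)
Definition new_labels (ks : seq nat) (S : seq (seq nat)) (mn : nat)
    (opp : seq label) : seq label :=
  [seq v <- [seq p :: s | p <- coordinates ks S 0,
                           s <- [seq [:: q; r] | q <- coordinates ks S 1,
                                                 r <- coordinates ks S 2]]
     | (mn <= count snd v) && all (agree v) opp].

Definition extend (ks : seq nat) (v : label) : seq nat :=
  [seq maxn p.1 p.2.1.+1 | p <- zip ks v].

Definition children (mn : nat) (q : query) (st : state) : seq state :=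
  let: (ks, xs, ys) := st in let S := chosen q in
  (if q.1.1.1 is R then [::] else
     [seq (extend ks v, v :: xs, ys) | v <- new_labels ks S mn ys]) ++
  (if q.1.1.1 is L then [::] else
     [seq (extend ks v, xs, v :: ys) | v <- new_labels ks S mn xs]).

(* [qs] lists the queries of the case tree in prefix order; the result is the
   part of the list that is left over. *)
Fixpoint refute (mn fuel : nat) (st : state) (qs : seq query) :
    option (seq query) :=
  if (fuel, qs) is (f.+1, q :: qs') then
    if admissible q then
      foldl (fun r st' => obind (refute mn f st') r) (Some qs') (children mn q st)
    else None
  else None.

(** * Soundness of the case tree *)

Section Soundness.
Variables (A B : finType) (K : eqType) (t mn : nat).
Variables (ca : nat -> A -> K) (ma : nat -> A -> bool).
Variables (cb : nat -> B -> K) (mb : nat -> B -> bool).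
Hypothesis sys : cover_system t ca ma cb mb.
Hypothesis min_ma : forall a, mn <= count (ma^~ a) (iota 0 3).
Hypothesis min_mb : forall b, mn <= count (mb^~ b) (iota 0 3).

Definition described (T : Type) (c : nat -> T -> K) (m : nat -> T -> bool)
    (nm : nat -> seq K) (v : label) (x : T) : Prop :=
  size v = 3 /\ forall i, i < 3 ->
    [/\ c i x \in nm i, (nth (0, false) v i).1 = index (c i x) (nm i)
      & m i x -> (nth (0, false) v i).2].

(** [nm i] lists the colour [i] components in order of discovery; labels refer to them by
    position. *)
Definition realizable (st : state) : Prop :=
  let: (ks, xs, ys) := st in size ks = 3 /\ exists nm : nat -> seq K,
   [/\ forall i, i < 3 -> size (nm i) = nth 0 ks i,
       forall v, v \in xs -> exists a, described ca ma nm v a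
     & forall w, w \in ys -> exists b, described cb mb nm w b].

Definition unmarked (T : Type) (c : nat -> T -> K) (m : nat -> T -> bool)
    (F : nat -> seq K) (x : T) := forall i, i < 3 -> c i x \in F i -> ~~ m i x.

(** Union bound: each listed component has at most [t] marked vertices on both sides together. *)
Lemma card_marked (F : nat -> seq K) :
  #|[pred a | has (fun i => (ca i a \in F i) && ma i a) (iota 0 3)]| +
  #|[pred b | has (fun i => (cb i b \in F i) && mb i b) (iota 0 3)]|
    <= sumn [seq size (F i) | i <- iota 0 3] * t.
Proof.
have [_ _ le_t _] := sys.
have: {subset iota 0 3 <= gtn 3} by move=> i; rewrite mem_iota.
elim: (iota 0 3) => [|i s IH] sub; first by rewrite /= !eq_card0.
have {}IH := IH (fun j js => sub j (mem_behead (s := _ :: _) js)).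
have i3 : i < 3 by apply: sub (mem_head _ _).
rewrite /= mulnDl.
have step1 (T : finType) (c : nat -> T -> K) (m : nat -> T -> bool) :
   #|[pred a | (c i a \in F i) && m i a || has (fun i => (c i a \in F i) && m i a) s]|
   <= #|[pred a | (c i a \in F i) && m i a]|
      + #|[pred a | has (fun i => (c i a \in F i) && m i a) s]|.
  rewrite -cardUI; apply: leq_trans (leq_addr _ _); apply: subset_leq_card.
  by apply/subsetP => a; rewrite !inE.
have step2 : #|[pred a | (ca i a \in F i) && ma i a]|
     + #|[pred b | (cb i b \in F i) && mb i b]| <= size (F i) * t.
  elim: (F i) => [|k ks IHk]; first by rewrite !eq_card0.
  have step3 (T : finType) (c : nat -> T -> K) (m : nat -> T -> bool) :
     #|[pred a | (c i a \in k :: ks) && m i a]|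
     <= #|[pred a | (c i a == k) && m i a]| + #|[pred a | (c i a \in ks) && m i a]|.
    rewrite -cardUI; apply: leq_trans (leq_addr _ _); apply: subset_leq_card.
    by apply/subsetP => a; rewrite !inE andb_orl.
  have := step3 _ ca ma; have := step3 _ cb mb; have := le_t i k i3; rewrite /= mulSn; lia.
have := step1 _ ca ma; have := step1 _ cb mb; lia.
Qed.

Lemma unmarkedPn (T : finType) (c : nat -> T -> K) (m : nat -> T -> bool) F :
  #|[pred a | has (fun i => (c i a \in F i) && m i a) (iota 0 3)]| < #|T| ->
  exists a, unmarked c m F a.
Proof.
move=> lt; have [/existsP[a na]|/existsPn all] :=
  boolP [exists a, ~~ has (fun i => (c i a \in F i) && m i a) (iota 0 3)].
  exists a => i i3 ciF; apply: contra na => mi; apply/hasP; exists i.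
    by rewrite mem_iota.
  by rewrite ciF.
suff: #|T| <= #|[pred a | has (fun i => (c i a \in F i) && m i a) (iota 0 3)]| by lia.
apply: subset_leq_card; apply/subsetP => a _; rewrite inE.
by have := all a; rewrite negbK.
Qed.

Lemma exists_unmarked_left F : sumn [seq size (F i) | i <- iota 0 3] <= 3 ->
  exists a, unmarked ca ma F a.
Proof.
move=> le3; apply: unmarkedPn; have [gtA _ _ _] := sys.
have := card_marked F; have := leq_mul2r t (sumn [seq size (F i) | i <- iota 0 3]) 3.
rewrite le3 orbT; lia.
Qed.

Lemma exists_unmarked_right F : sumn [seq size (F i) | i <- iota 0 3] <= 3 ->
  exists b, unmarked cb mb F b.
Proof.
move=> le3; apply: unmarkedPn; have [_ gtB _ _] := sys.
have := card_marked F; have := leq_mul2r t (sumn [seq size (F i) | i <- iota 0 3]) 3.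
rewrite le3 orbT; lia.
Qed.

Lemma exists_unmarked F : sumn [seq size (F i) | i <- iota 0 3] <= 6 ->
  (exists a, unmarked ca ma F a) \/ (exists b, unmarked cb mb F b).
Proof.
move=> le6; have [gtA gtB _ _] := sys.
have := card_marked F; have := leq_mul2r t (sumn [seq size (F i) | i <- iota 0 3]) 6.
rewrite le6 orbT => le6t le.
have [ltA|geA] :=
  ltnP #|[pred a | has (fun i => (ca i a \in F i) && ma i a) (iota 0 3)]| #|A|.
  by left; apply: unmarkedPn.
right; apply: unmarkedPn; lia.
Qed.

Definition add_names (T : Type) (c : nat -> T -> K) (x : T) (nm : nat -> seq K) i :=
  if c i x \in nm i then nm i else rcons (nm i) (c i x).

(** Names are only appended, so the position of a listed name never changes. *)
Lemma described_add_names (S T : Type) (c : nat -> T -> K) (x : T)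
    (d : nat -> S -> K) (m : nat -> S -> bool) nm v y :
  described d m nm v y -> described d m (add_names c x nm) v y.
Proof.
case=> sz dv; split=> // i i3; have [yn -> mv] := dv i i3.
rewrite /add_names; case: ifP => // _; split=> //.
  by rewrite mem_rcons inE yn orbT.
by rewrite -cats1 index_cat yn.
Qed.

(** Positions refer to [nm] before [x] is added: a new component gets position [size (nm i)], where
    [add_names] then puts it. *)
Definition label_of (T : Type) (c : nat -> T -> K) (nm : nat -> seq K)
    (S : seq (seq nat)) (x : T) : label :=
  [seq (index (c i x) (nm i),
        ~~ ((index (c i x) (nm i) < size (nm i)) && (index (c i x) (nm i) \in nth [::] S i)))
     | i <- iota 0 3].

(** A selected index outside the list is read as [k0]. This is harmless: the vertex sought avoids
    one more component, which the size of the query already counts. *)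
Definition chosen_names k0 (nm : nat -> seq K) (S : seq (seq nat)) i : seq K :=
  [seq nth k0 (nm i) j | j <- nth [::] S i].

Lemma described_label_of k0 (T : Type) (c : nat -> T -> K) m nm S x :
    unmarked c m (chosen_names k0 nm S) x ->
  described c m (add_names c x nm) (label_of c nm S x) x.
Proof.
move=> un; split=> [|i i3]; first by rewrite size_map.
rewrite /label_of (nth_map 0) ?size_iota // nth_iota // add0n /=.
split.
- by rewrite /add_names; case: ifP => // _; rewrite mem_rcons mem_head.
- rewrite /add_names; case: ifPn => // cn.
  by rewrite -cats1 index_cat (negbTE cn) /= eqxx addn0 memNindex.
- apply: contraL => /andP[lt jS]; apply: un => //.
  by apply/mapP; exists (index (c i x) (nm i)); rewrite ?nth_index // -index_mem.
Qed.

Lemma agree_described a b nm v w :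
  described ca ma nm v a -> described cb mb nm w b -> agree v w.
Proof.
move=> [sv dv] [sw dw]; have [_ _ _ /(_ a b)[i i3 /andP[/eqP eq_c mm]]] := sys.
apply/hasP; exists (nth (0, false) v i, nth (0, false) w i).
  by rewrite -nth_zip ?sv ?sw // mem_nth // size_zip sv sw.
have [_ /= -> va] := dv i i3; have [_ -> wb] := dw i i3.
by rewrite eq_c eqxx; case/orP: mm => [/va->|/wb->] //; rewrite orbT.
Qed.

Lemma label_of_new_labels (T : Type) (c : nat -> T -> K) m k0 nm S ks opp x :
    (forall i, i < 3 -> size (nm i) = nth 0 ks i) ->
    unmarked c m (chosen_names k0 nm S) x ->
    mn <= count (m^~ x) (iota 0 3) ->
    (forall v, v \in opp -> agree (label_of c nm S x) v) ->
  label_of c nm S x \in new_labels ks S mn opp.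
Proof.
move=> sz un min_m ag; rewrite mem_filter -andbA; apply/and3P; split.
- have [_ dl] := described_label_of un; apply: leq_trans min_m _.
  have le_m i : i < 3 -> m i x <= (nth (0, false) (label_of c nm S x) i).2.
    by move=> /dl[_ _]; case: (m i x) => // ->.
  by rewrite /= !leq_add // (le_m 0, le_m 1, le_m 2).
- by apply/allP.
have crd i : i < 3 -> (index (c i x) (nm i),
     ~~ ((index (c i x) (nm i) < size (nm i)) && (index (c i x) (nm i) \in nth [::] S i)))
     \in coordinates ks S i.
  move=> i3; apply/mapP; exists (index (c i x) (nm i)); rewrite -?sz //.
  by rewrite mem_iota ltnS index_size.
have tl := allpairs_f (fun q r => [:: q; r]) (crd 1 isT) (crd 2 isT).
exact: (allpairs_f cons (crd 0 isT) tl).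
Qed.

Lemma size_add_names (T : Type) (c : nat -> T -> K) x nm S ks :
    size ks = 3 -> (forall i, i < 3 -> size (nm i) = nth 0 ks i) ->
  size (extend ks (label_of c nm S x)) = 3 /\
  forall i, i < 3 -> size (add_names c x nm i) = nth 0 (extend ks (label_of c nm S x)) i.
Proof.
move=> szk sz; split; first by rewrite size_map size_zip szk.
move=> i i3; rewrite (nth_map (0, (0, false))) ?size_zip ?szk //.
rewrite nth_zip ?szk //= /label_of (nth_map 0) ?size_iota // nth_iota //= -sz // add0n.
rewrite /add_names; case: ifPn => cn; first by apply/esym/maxn_idPl; rewrite index_mem.
by rewrite size_rcons memNindex //; apply/esym/maxn_idPr.
Qed.

(** The counting bound supplies a vertex answering the query. Its label is among those enumerated,
    because [new_labels] misses no label compatible with the edges to the known vertices. *)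
Lemma realizable_children q st : admissible q -> realizable st ->
  exists2 st', st' \in children mn q st & realizable st'.
Proof.
case: st => [[ks xs] ys] adm [szk [nm [sz dx dy]]].
have [gtA _ _ _] := sys.
have /card_gt0P[a0 _] : 0 < #|A| by apply: leq_trans gtA.
pose S := chosen q; pose F := chosen_names (ca 0 a0) nm S.
have sizeF : sumn [seq size (F i) | i <- iota 0 3] = sumn [seq size s | s <- chosen q].
  rewrite /F /chosen_names /S; case: q {adm S F} => [[[s m0] m1] m2] /=.
  by rewrite !size_map.
have left a : q.1.1.1 <> R -> unmarked ca ma F a ->
    exists2 st', st' \in children mn q (ks, xs, ys) & realizable st'.
  move=> qR un; set v := label_of ca nm S a.
  have dv := described_label_of un.
  have v_new : v \in new_labels ks S mn ys.
    apply: (label_of_new_labels sz un) => // w /dy[b db].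
    by apply: agree_described dv _; apply: described_add_names db.
  exists (extend ks v, v :: xs, ys).
    by rewrite mem_cat; apply/orP; left; case: q.1.1.1 qR => // _; apply: map_f.
  have [szk' sz'] := size_add_names ca a S szk sz.
  split=> //; exists (add_names ca a nm); split=> //.
  - move=> w; rewrite inE => /predU1P[->|/dx[x dwx]]; first by exists a.
    by exists x; apply: described_add_names.
  - by move=> w /dy[b db]; exists b; apply: described_add_names.
have right b : q.1.1.1 <> L -> unmarked cb mb F b ->
    exists2 st', st' \in children mn q (ks, xs, ys) & realizable st'.
  move=> qL un; set v := label_of cb nm S b.
  have dv := described_label_of un.
  have v_new : v \in new_labels ks S mn xs.
    apply: (label_of_new_labels sz un) => // w /dx[a da]; rewrite agreeC.
    by apply: agree_described dv; apply: described_add_names da.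
  exists (extend ks v, xs, v :: ys).
    by rewrite mem_cat; apply/orP; right; case: q.1.1.1 qL => // _; apply: map_f.
  have [szk' sz'] := size_add_names cb b S szk sz.
  split=> //; exists (add_names cb b nm); split=> //.
  - by move=> w /dx[a da]; exists a; apply: described_add_names.
  - move=> w; rewrite inE => /predU1P[->|/dy[x dwx]]; first by exists b.
    by exists x; apply: described_add_names.
move: adm; rewrite /admissible -sizeF; case: q.1.1.1 left right => left right le.
- by have [a un] := exists_unmarked_left le; apply: (left a).
- by have [b un] := exists_unmarked_right le; apply: (right b).
by have [[a un]|[b un]] := exists_unmarked le; [apply: (left a)|apply: (right b)].
Qed.

(** A realizable state has a realizable child, yet every child is refuted by its own share of the
    queries. *)
Lemma refute_sound fuel st qs : isSome (refute mn fuel st qs) -> ~ realizable st.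
Proof.
elim: fuel st qs => [|f IH] st [|q qs] //=.
case: ifP => // adm ref /(realizable_children adm)[st' + rst'].
elim: (children _ _ _) (Some qs) ref => //= st1 sts IHs r ref.
rewrite inE => /predU1P[eq_st|]; last exact: IHs ref.
(* [None] is passed on to the end of the fold, so success overall means that each child was
   refuted. *)
case: r ref => [r|] /=; last by elim: {IHs} sts.
case Er: (refute mn f st1 r) => [r'|]; last by elim: {IHs} sts.
by move=> _; apply: (IH st' r) rst'; rewrite eq_st Er.
Qed.

End Soundness.

(** * Symmetries of cover systems *)

Section Symmetry.
Variables (A B : finType) (K : eqType) (t : nat).
Variables (ca : nat -> A -> K) (ma : nat -> A -> bool).
Variables (cb : nat -> B -> K) (mb : nat -> B -> bool).
Hypothesis sys : cover_system t ca ma cb mb.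

Lemma cover_system_sym : cover_system t cb mb ca ma.
Proof.
have [gtA gtB le_t cross] := sys; split=> // [i k i3|b a].
  by rewrite addnC; apply: le_t.
by have [i i3 cm] := cross a b; exists i; rewrite // eq_sym orbC.
Qed.

Lemma cover_system_perm (s : nat -> nat) :
    (forall i, i < 3 -> s i < 3) -> (forall i, i < 3 -> s (s i) = i) ->
  cover_system t (ca \o s) (ma \o s) (cb \o s) (mb \o s).
Proof.
move=> s3 sK; have [gtA gtB le_t cross] := sys; split=> // [i k i3|a b].
  exact/le_t/s3.
by have [i i3 cm] := cross a b; exists (s i); [exact: s3|rewrite /= sK].
Qed.

(** Take [b] unmarked in the three components of [a]: the edge between them can then be covered only
    by a mark of [a]. *)
Lemma has_mark a : 0 < count (ma^~ a) (iota 0 3).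
Proof.
have [b un] := exists_unmarked_right sys (F := fun i => [:: ca i a]) isT.
have [_ _ _ /(_ a b)[i i3 /andP[/eqP eq_c mm]]] := sys.
rewrite -has_count; apply/hasP; exists i; first by rewrite mem_iota.
by have := un i i3; rewrite inE eq_c eqxx => /(_ isT)/negbTE mF; rewrite mF orbF in mm.
Qed.
End Symmetry.

(** * The two case trees and the nonexistence of cover systems *)

Definition certificate_two_marks : seq query := [::
  (R,0,0,0); (R,1,1,1); (L,1,2,2); (LR,3,3,3); (L,3,0,2); (LR,3,3,6);
  (L,1,3,0); (LR,7,3,2); (LR,7,3,1); (L,5,1,0); (LR,3,3,3); (L,3,2,0);
  (LR,3,6,3); (L,1,0,3); (LR,7,1,3); (L,5,0,1); (LR,7,2,3); (L,2,1,2);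
  (LR,3,3,3); (L,3,1,0); (LR,3,7,2); (LR,3,7,1); (L,1,5,0); (L,0,3,2);
  (LR,3,3,6); (LR,3,3,3); (L,2,3,0); (LR,6,3,3); (L,0,1,3); (LR,1,7,3);
  (L,0,5,1); (LR,2,7,3); (L,2,2,1); (LR,3,3,3); (L,3,0,1); (LR,3,2,7);
  (LR,3,1,7); (L,1,0,5); (L,0,2,3); (LR,3,6,3); (LR,3,3,3); (L,0,3,1);
  (LR,1,3,7); (L,0,1,5); (LR,2,3,7); (L,2,0,3); (LR,6,3,3); (LR,3,3,3);
  (L,1,4,4); (L,3,0,4); (LR,3,5,6); (LR,3,5,5); (L,3,4,0); (LR,3,6,5);
  (LR,3,5,5); (L,2,4,4); (L,3,0,4); (LR,3,6,6); (LR,3,6,5); (L,3,4,0);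
  (LR,3,6,6); (LR,3,5,6); (L,4,1,4); (L,0,3,4); (LR,5,3,6); (LR,5,3,5);
  (L,4,3,0); (LR,5,3,5); (LR,6,3,5); (L,4,2,4); (L,0,3,4); (LR,6,3,6);
  (LR,6,3,5); (L,4,3,0); (LR,5,3,6); (LR,6,3,6); (L,4,4,1); (L,0,4,3);
  (LR,5,5,3); (LR,5,6,3); (L,4,0,3); (LR,5,5,3); (LR,6,5,3); (L,4,4,2);
  (L,0,4,3); (LR,6,5,3); (LR,6,6,3); (L,4,0,3); (LR,5,6,3); (LR,6,6,3);
  (L,7,0,0); (LR,7,6,4); (LR,5,3,6); (LR,7,7,0); (L,0,1,6); (L,0,6,1);
  (L,1,6,0); (LR,5,3,6); (L,0,7,0); (L,0,0,7); (LR,7,6,2); (LR,3,5,6);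
  (LR,7,7,0); (L,0,1,6); (L,0,6,1); (L,1,6,0); (LR,3,5,6); (L,0,7,0);
  (L,0,0,7); (LR,7,5,4); (LR,6,3,5); (LR,7,7,0); (L,2,5,0); (LR,6,3,5);
  (L,0,5,2); (L,0,7,0); (L,0,2,5); (L,0,0,7); (LR,7,5,1); (LR,3,6,5);
  (LR,7,7,0); (L,0,2,5); (L,0,5,2); (L,2,5,0); (LR,3,6,5); (L,0,7,0);
  (L,0,0,7); (LR,7,3,2); (LR,6,5,3); (LR,7,7,0); (L,4,3,0); (LR,6,5,3);
  (L,0,3,4); (L,0,7,0); (L,0,4,3); (L,0,0,7); (LR,7,3,1); (LR,5,6,3);
  (LR,7,7,0); (L,4,3,0); (LR,5,6,3); (L,0,3,4); (L,0,7,0); (L,0,4,3);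
  (L,0,0,7)].

Definition certificate_one_mark : seq query := [::
  (R,1,1,1); (L,1,1,2); (LR,1,3,3); (R,1,2,2); (R,0,1,3); (R,0,2,3);
  (R,1,0,3); (L,1,3,0); (R,0,1,3); (LR,3,3,3); (R,1,0,3); (R,0,1,3);
  (R,0,1,3); (R,0,2,3); (R,0,2,3); (L,1,3,0); (L,1,2,1); (LR,1,3,3);
  (R,1,2,2); (R,0,3,1); (R,0,3,2); (R,1,3,0); (L,1,0,3); (R,0,3,1);
  (LR,3,3,3); (R,1,3,0); (R,0,3,1); (R,0,3,1); (R,0,3,2); (R,0,3,2);
  (L,1,0,3); (L,1,2,2); (R,1,1,2); (LR,1,3,3); (R,0,3,1); (L,1,3,0);
  (LR,1,3,7); (R,0,3,4); (LR,3,3,5); (L,1,1,1); (LR,3,3,3); (R,3,2,0);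
  (LR,3,3,6); (LR,3,3,6); (LR,3,3,6); (R,2,3,0); (R,3,0,2); (R,0,3,1);
  (L,3,1,0); (LR,3,3,6); (R,1,2,1); (LR,1,3,3); (R,0,1,3); (L,1,0,3);
  (LR,1,7,3); (R,0,4,3); (LR,3,5,3); (L,1,1,1); (LR,3,3,3); (R,3,2,0);
  (R,3,0,2); (LR,3,6,3); (LR,3,6,3); (LR,3,6,3); (R,2,0,3); (R,0,1,3);
  (L,3,0,1); (LR,3,6,3); (R,1,2,4); (L,1,1,4); (R,1,3,0); (R,1,3,0);
  (L,1,4,4); (R,1,6,0); (R,1,6,0); (L,3,0,4); (LR,3,6,6); (R,1,3,0);
  (L,1,1,4); (LR,3,3,5); (L,1,2,4); (R,0,3,4); (L,3,0,4); (LR,3,6,6);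
  (LR,3,6,6); (R,1,4,2); (L,1,4,1); (R,1,0,3); (R,1,0,3); (L,1,4,4);
  (R,1,0,6); (R,1,0,6); (L,3,4,0); (LR,3,6,6); (R,1,0,3); (L,1,4,1);
  (LR,3,5,3); (L,1,4,2); (R,0,4,3); (L,3,4,0); (LR,3,6,6); (LR,3,6,6);
  (R,0,1,3); (LR,3,3,3); (R,1,3,0); (LR,1,3,7); (R,1,0,3); (L,1,3,0);
  (LR,1,3,7); (LR,3,3,3); (R,1,3,0); (LR,3,3,6); (R,1,0,3); (L,3,1,0);
  (LR,1,3,7); (LR,1,3,7); (R,1,3,0); (LR,1,3,11); (R,1,0,3); (R,0,3,4);
  (LR,3,3,5); (LR,3,3,5); (LR,3,3,5); (R,1,2,1); (LR,3,5,3); (R,3,2,0);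
  (R,0,3,4); (LR,5,3,5); (L,1,3,0); (LR,1,3,11); (R,0,3,1); (LR,3,3,3);
  (R,1,3,0); (R,1,0,3); (LR,1,7,3); (L,1,0,3); (LR,1,7,3); (LR,3,3,3);
  (R,1,3,0); (R,1,0,3); (LR,3,6,3); (L,3,0,1); (LR,1,7,3); (LR,1,7,3);
  (R,1,3,0); (R,1,0,3); (LR,1,11,3); (R,0,4,3); (LR,3,5,3); (LR,3,5,3);
  (LR,3,5,3); (R,1,1,2); (LR,3,3,5); (R,3,0,2); (R,0,4,3); (LR,5,5,3);
  (L,1,0,3); (LR,1,11,3); (LR,3,3,3); (R,0,3,2); (R,0,2,3); (R,2,3,0);
  (R,2,0,3); (R,0,3,2); (R,0,2,3); (R,0,3,2); (R,0,3,2); (R,0,2,3);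
  (R,1,3,0); (LR,3,3,5); (R,0,3,4); (L,1,2,4); (LR,3,3,5); (R,0,3,4);
  (L,3,0,4); (LR,3,7,4); (R,1,6,0); (LR,3,6,6); (R,0,4,3); (L,3,0,2);
  (R,2,6,0); (LR,3,7,2); (R,0,5,2); (R,0,3,4); (R,0,7,0); (L,1,0,6);
  (L,3,2,0); (L,3,2,0); (L,3,4,0); (L,3,0,4); (LR,3,3,5); (R,2,3,0);
  (R,0,3,1); (R,0,3,1); (R,0,3,1); (LR,3,7,4); (R,3,2,0); (LR,3,6,3);
  (R,2,6,0); (LR,3,7,2); (L,3,4,0); (LR,3,6,5); (R,0,3,1); (L,3,0,4);
  (LR,3,4,7); (L,1,0,6); (L,3,0,2); (LR,3,3,5); (R,0,3,1); (R,2,3,0);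
  (R,2,3,0); (R,0,3,1); (LR,3,6,5); (R,2,6,0); (LR,3,7,2); (L,3,4,0);
  (LR,3,7,2); (LR,3,7,2); (R,0,3,1); (L,1,0,6); (L,1,4,4); (L,3,0,4);
  (LR,3,5,6); (L,3,4,0); (R,0,3,1); (LR,1,7,5); (R,1,6,0); (LR,3,7,2);
  (LR,3,6,6); (R,3,2,0); (LR,3,3,5); (R,0,2,5); (LR,3,7,4); (LR,3,7,2);
  (R,2,2,4); (L,3,4,0); (L,1,0,5); (LR,1,7,5); (R,1,6,0); (LR,3,6,6);
  (L,3,0,2); (LR,3,3,5); (R,0,2,5); (LR,3,6,6); (L,3,0,2); (L,3,4,0);
  (LR,3,7,1); (L,1,0,5); (LR,3,7,4); (R,1,2,1); (LR,3,3,5); (LR,3,6,5);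
  (R,2,6,0); (R,1,6,0); (LR,3,6,6); (R,0,4,3); (L,3,0,2); (R,2,6,0);
  (LR,3,7,2); (R,1,4,2); (R,0,7,0); (L,1,8,4); (L,3,0,4); (LR,3,3,5);
  (L,3,2,0); (LR,3,3,5); (L,3,4,0); (LR,3,6,5); (L,3,0,1); (L,3,2,0);
  (LR,3,11,1); (L,3,0,2); (LR,3,10,5); (R,1,2,1); (R,2,10,0); (L,3,0,1);
  (R,1,0,3); (LR,3,4,7); (LR,3,6,6); (LR,3,10,5); (R,3,2,0); (LR,3,6,6);
  (R,2,10,0); (L,1,0,6); (L,1,0,5); (LR,3,6,6); (L,1,2,4); (L,3,0,4);
  (L,5,0,4); (LR,3,8,7); (R,1,0,3); (R,1,0,3); (R,2,2,4); (R,1,0,3);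
  (LR,3,5,3); (R,0,4,3); (L,1,4,2); (LR,3,5,3); (R,0,4,3); (L,3,4,0);
  (LR,3,4,7); (R,1,0,6); (LR,3,6,6); (R,0,3,4); (L,3,2,0); (R,2,0,6);
  (LR,3,2,7); (R,0,2,5); (R,0,0,7); (R,0,4,3); (L,1,6,0); (L,3,0,2);
  (L,3,0,2); (L,3,0,4); (L,3,4,0); (LR,3,5,3); (R,2,0,3); (R,0,1,3);
  (R,0,1,3); (LR,3,4,7); (R,3,0,2); (LR,3,3,6); (R,2,0,6); (LR,3,2,7);
  (L,3,0,4); (LR,3,5,6); (R,0,1,3); (R,0,1,3); (L,3,4,0); (LR,3,7,4);
  (L,1,6,0); (L,3,2,0); (LR,3,5,3); (R,0,1,3); (R,2,0,3); (R,0,1,3);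
  (LR,3,5,6); (R,2,0,6); (LR,3,2,7); (L,3,0,4); (LR,3,2,7); (LR,3,2,7);
  (R,2,0,3); (R,0,1,3); (L,1,6,0); (L,1,4,4); (L,3,4,0); (LR,3,6,5);
  (L,3,0,4); (R,0,1,3); (LR,1,5,7); (R,1,0,6); (LR,3,2,7); (LR,3,6,6);
  (R,3,0,2); (LR,3,5,3); (R,0,5,2); (LR,3,4,7); (LR,3,2,7); (R,2,4,2);
  (L,3,0,4); (L,1,5,0); (LR,1,5,7); (R,1,0,6); (LR,3,6,6); (L,3,2,0);
  (LR,3,5,3); (R,0,5,2); (LR,3,6,6); (L,3,0,4); (LR,3,1,7); (L,3,2,0);
  (L,1,5,0); (LR,3,4,7); (R,1,1,2); (LR,3,5,3); (LR,3,5,6); (R,2,0,6);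
  (R,1,0,6); (LR,3,6,6); (R,0,3,4); (L,3,2,0); (R,2,0,6); (LR,3,2,7);
  (R,1,2,4); (R,0,0,7); (L,1,4,8); (L,3,4,0); (LR,3,5,3); (L,3,0,2);
  (LR,3,5,3); (L,3,0,4); (LR,3,5,6); (L,3,1,0); (L,3,0,2); (LR,3,1,11);
  (L,3,2,0); (LR,3,5,10); (R,1,1,2); (R,2,0,10); (L,3,1,0); (R,1,3,0);
  (LR,3,7,4); (LR,3,6,6); (LR,3,7,8); (R,1,3,0); (R,1,3,0); (R,2,4,2);
  (LR,3,5,10); (R,3,0,2); (LR,3,6,6); (R,2,0,10); (L,1,6,0); (L,1,5,0);
  (LR,3,6,6); (L,1,4,2); (L,3,4,0); (L,5,4,0)].

Section Contradiction.
Variables (A B : finType) (K : eqType) (t : nat).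
Variables (ca : nat -> A -> K) (ma : nat -> A -> bool).
Variables (cb : nat -> B -> K) (mb : nat -> B -> bool).
Hypothesis sys : cover_system t ca ma cb mb.

Lemma not_all_two_marks :
    (forall a, 1 < count (ma^~ a) (iota 0 3)) ->
    (forall b, 1 < count (mb^~ b) (iota 0 3)) ->
  False.
Proof.
move=> two_ma two_mb.
(* The root of the tree has no known component or vertex. The number 100 is fuel, a bound on the
   depth. *)
have := @refute_sound _ _ _ t 2 ca ma cb mb sys two_ma two_mb 100
  ([:: 0; 0; 0], [::], [::]) certificate_two_marks.
apply; first by vm_compute.
by split=> //; exists (fun=> [::]); split=> //; do 3?case.
Qed.

Lemma not_only_first_mark a : ma 1 a = false -> ma 2 a = false -> False.
Proof.
move=> ma1 ma2.
(* At the root only [a] is known. Its components have position 0 in each colour, and only its first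
   flag is [true]. *)
have := @refute_sound _ _ _ t 1 ca ma cb mb sys (has_mark sys)
  (has_mark (cover_system_sym sys)) 100
  ([:: 1; 1; 1], [:: [:: (0, true); (0, false); (0, false)]], [::]) certificate_one_mark.
apply; first by vm_compute.
split=> //; exists (fun i => [:: ca i a]); split=> //; first by do 3?case.
move=> v /predU1P[->|//]; exists a; split=> // -[|[|[|]]] //= _.
all: by rewrite mem_head eqxx ?ma1 ?ma2.
Qed.
End Contradiction.

(** If [a] had at most one mark, exchanging the colour of that mark with colour 0 would give the
    case excluded by [not_only_first_mark]. *)
Lemma at_least_two_marks (A B : finType) (K : eqType) t ca ma cb mb
    (sys : @cover_system A B K t ca ma cb mb) a :
  1 < count (ma^~ a) (iota 0 3).
Proof.
rewrite ltnNge; apply/negP => le1.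
have [i i3 only] : exists2 i, i < 3 & forall j, j < 3 -> j != i -> ma j a = false.
  move: le1; rewrite /=.
  case m0: (ma 0 a); case m1: (ma 1 a); case m2: (ma 2 a) => // _;
    (* The last case has no mark at all, and any colour would serve. *)
    [exists 0|exists 1|exists 2|exists 0] => //; case=> [|[|[|]]] //.
pose s j := if j == 0 then i else if j == i then 0 else j.
have s3 j : j < 3 -> s j < 3.
  by rewrite /s {only s}; case: i i3 => [|[|[|]]] // _; case: j => [|[|[|]]].
have sK j : j < 3 -> s (s j) = j.
  by rewrite /s {only s s3}; case: i i3 => [|[|[|]]] // _; case: j => [|[|[|]]].
apply: (not_only_first_mark (cover_system_perm sys s3 sK) (a := a)); apply: only.
all: by rewrite ?s3 // /s {s s3 sK}; case: i i3 => [|[|[|]]].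
Qed.

Lemma no_cover_system (A B : finType) (K : eqType) t ca ma cb mb :
  ~ @cover_system A B K t ca ma cb mb.
Proof.
move=> sys; apply: (not_all_two_marks sys) => x; first exact: (at_least_two_marks sys).
exact: (at_least_two_marks (cover_system_sym sys)).
Qed.

(** * Colourings *)

Definition nth_colour (i : nat) : colour := nth Red [:: Red; Green; Blue] i.

Lemma nth_colour_onto C : exists2 i, i < 3 & nth_colour i = C.
Proof. by case: C; [exists 0|exists 1|exists 2]. Qed.

Section Components.
Variables (n : nat) (c : colouring n).

Lemma colour_adj_sym C : connect_sym (colour_adj c C).
Proof. by apply: sym_connect_sym => -[x|x] [y|y]. Qed.

(** Testing the left end is enough, since the edge itself leads on to the right end. *)
Definition component_edge C v (i j : 'I_n) :=
  (c (i, j) == C) && connect (colour_adj c C) v (inl i).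

Lemma connected_matching_of C v M :
  matching_of (component_edge C v) M -> connected_matching c C M.
Proof.
move=> [edges disj]; apply/and3P; split.
- apply/'forall_implyP => p pM; apply/'forall_implyP => q qM; apply/implyP; exact: disj.
- by apply/'forall_implyP => -[i j] /edges/andP[].
apply/existsP; exists v; apply/'forall_implyP => -[i j] /edges /andP[/= cC vi].
by rewrite vi; apply: connect_trans vi (connect1 _).
Qed.

(** König's theorem gives each component a cover of at most [t] vertices. Components are named by
    their canonical [root], so the two ends of an edge share a name in its colour. *)
Lemma cover_system_of_colouring t : 3 * t < n ->
    (forall C, ~ has_connected_matching c C t.+1) ->
  exists ca ma cb mb, @cover_system 'I_n 'I_n (vertex n) t ca ma cb mb.
Proof.
move=> lt_n noM.
have /fin_all_exists[D covD] : forall Cv : colour * vertex n,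
    exists D : {set 'I_n} * {set 'I_n},
      vertex_cover (component_edge Cv.1 Cv.2) D.1 D.2 /\ #|D.1| + #|D.2| <= t.
  move=> [C v]; have [[M M_m Mc]|[D cov lt]] := konig_cover t.+1 (component_edge C v).
    by case: (noM C); exists M; split=> //; apply: connected_matching_of M_m.
  by exists D.
pose comp i x : vertex n := root (colour_adj c (nth_colour i)) x.
exists (fun i a => comp i (inl a)),
  (fun i a => a \in (D (nth_colour i, comp i (inl a))).1).
exists (fun i b => comp i (inr b)),
  (fun i b => b \in (D (nth_colour i, comp i (inr b))).2).
split=> [||i k i3|a b]; rewrite ?card_ord //.
  have [_] := covD (nth_colour i, k); apply: leq_trans.
  by apply: leq_add; apply: subset_leq_card; apply/subsetP => x;
    rewrite inE => /andP[/eqP->].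
have [i i3 ci] := nth_colour_onto (c (a, b)); exists i => //.
have symC := colour_adj_sym (nth_colour i).
have <- : comp i (inl a) = comp i (inr b).
  by apply/(rootP symC)/connect1; rewrite /= ci.
(* The cover of this component contains an end of the edge, which is the required mark. *)
rewrite eqxx; have [cov _] := covD (nth_colour i, comp i (inl a)).
by apply: cov; rewrite /component_edge /= ci eqxx -ci symC connect_root.
Qed.
End Components.

(** * The lower bound *)

Lemma card_interval s n q : n <= 3 * s -> #|[set i : 'I_n | i %/ s == q]| <= s.
Proof.
(* For [s = 0] the bound forces [n = 0]. *)
case: s => [|s] le_n; first by apply: leq_trans (max_card _) _; rewrite card_ord.
rewrite -[X in _ <= X]card_ord.
(* Remainders separate the numbers with a common quotient. *)
rewrite -(@card_in_imset _ _ (fun i : 'I_n => inord (i %% s.+1) : 'I_s.+1)).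
  exact: max_card.
move=> i j; rewrite !inE => /eqP iq /eqP jq /(congr1 val) /=.
rewrite !inordK ?ltn_pmod // => ij; apply: val_inj.
by rewrite /= (divn_eq i s.+1) (divn_eq j s.+1) iq jq ij.
Qed.

Lemma ramsey_lower_bound s n : ramsey_prop s.+1 s.+1 s.+1 n -> 3 * s < n.
Proof.
move=> ram; rewrite ltnNge; apply/negP => le_n.
pose c : colouring n := [ffun e : edge n => nth_colour (e.1 %/ s)].
suff noM C : ~ has_connected_matching c C s.+1 by case: (ram c) => /noM.
case=> M [/and3P[/'forall_implyP disj /'forall_implyP colM _] cardM].
have [q q3 qC] := nth_colour_onto C.
have: #|M| <= #|[set i : 'I_n | i %/ s == q]|.
  (* Edges of a matching have distinct left ends. *)
  rewrite -(@card_in_imset _ _ (fun e : edge n => e.1)); last first.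
    move=> e f eM fM ef; apply/eqP; have /'forall_implyP/(_ f fM)/implyP := disj e eM.
    by rewrite ef eqxx => /contraT; case: eqP => // _ /(_ isT).
  apply: subset_leq_card; apply/subsetP => _ /imsetP[e eM ->].
  have := colM e eM; rewrite ffunE inE -qC => /eqP eq_col.
  (* The quotient has to be below 3, as [nth_colour] falls back to [Red] from there on. *)
  have s0 : 0 < s by have := ltn_ord e.1; lia.
  have : e.1 %/ s < 3 by rewrite ltn_divLR //; have := ltn_ord e.1; lia.
  by move: (e.1 %/ s) q3 eq_col; case: q {qC} => [|[|[|]]] // [|[|[|]]].
by rewrite cardM => /leq_trans/(_ (card_interval q le_n)); rewrite ltnn.
Qed.

(** A finite search decides the question, so the case distinction on the three colours is
    constructive. *)
Lemma has_connected_matching_dec n (c : colouring n) C k :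
  has_connected_matching c C k \/ ~ has_connected_matching c C k.
Proof.
have [/existsP[M /andP[cM /eqP kM]]|no] :=
  boolP [exists M, connected_matching c C M && (#|M| == k)]; first by left; exists M.
by right=> -[M [cM kM]]; case/existsP: no; exists M; rewrite cM kM eqxx.
Qed.

Theorem theorem4 (k : nat) (k_gt0 : 0 < k) :
  is_ramsey_number k k k (3 * k - 2).
Proof.
case: k k_gt0 => // s _; have -> : 3 * s.+1 - 2 = (3 * s).+1 by lia.
split=> [c|n]; last exact: ramsey_lower_bound.
have [|noR] := has_connected_matching_dec c Red s.+1; first by constructor 1.
have [|noG] := has_connected_matching_dec c Green s.+1; first by constructor 2.
have [|noB] := has_connected_matching_dec c Blue s.+1; first by constructor 3.
have [|ca [ma [cb [mb sys]]]] := @cover_system_of_colouring _ c s (ltnSn _).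
  by case.
by case: (no_cover_system sys).
Qed.
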